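(* There exist absolute constants $c_1,c_2\in\mathbb N$ with the following property. Let $d\in\mathbb N$, let $D_d\subset\mathbb R^d$ be compact, let $\varrho_d$ be a probability measure on $D_d$ with full support, and let $H(K_d)$ be a reproducing kernel Hilbert space of complex-valued functions on $D_d$ with a Hermitian positive definite continuous kernel $K_d$ satisfying $\sup_{\mathbf x\in D_d}K_d(\mathbf x,\mathbf x)<\infty$, such that all eigenvalues of $W_d=I_{2,d}^*I_{2,d}$ are positive. Then for every $m\in\mathbb N$, $$ g_{c_1m}(I_{\infty,d})^2\le c_2\max\Big\{\frac{N_{\varrho_d}(m)}{m}\sum_{k\ge \lfloor m/2\rfloor}\sigma_{k,d}^2,\ \sum_{k\ge\lfloor m/4\rfloor}\frac{N_{\varrho_d}(4k)\,\sigma_{k,d}^2}{k}\Big\},$$ where the sums range over integers $k\ge 1$ satisfying the indicated lower bound.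
   Context: $I_{q,d}:H(K_d)\to L_q(\varrho_d)$, $I_{q,d}f=f$, where $L_\infty(D_d)$ carries the norm $\|f\|_\infty=\sup_{\mathbf x\in D_d}|f(\mathbf x)|$. Let $(\lambda_{k,d},e_{k,d})_{k\in\mathbb N}$ be the eigenpairs of the compact operator $W_d=I_{2,d}^*I_{2,d}:H(K_d)\to H(K_d)$ with $\lambda_{1,d}\ge\lambda_{2,d}\ge\dots>0$ and $\{e_{k,d}\}$ an orthonormal basis of $H(K_d)$; set $\sigma_{k,d}=\sqrt{\lambda_{k,d}}$ and $\eta_{k,d}=\lambda_{k,d}^{-1/2}e_{k,d}$. For $m\in\mathbb N$, $N_{\varrho_d}(m)=\sup_{\mathbf x\in D_d}\sum_{k=1}^m|\eta_{k,d}(\mathbf x)|^2$. The sampling number $g_n(I_{\infty,d})$ is the infimum, over all algorithms of the form $A(f)=\phi(f(\mathbf x^1),\dots,f(\mathbf x^n))$ with points $\mathbf x^i\in D_d$ and arbitrary mappings $\phi:\mathbb C^n\to L_\infty(D_d)$, of $\sup_{\|f\|_{H(K_d)}\le1}\|f-A(f)\|_\infty$. *)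

(* Defs.v *)
From HB Require Import structures.
From mathcomp Require Import all_boot all_order all_algebra.
From mathcomp Require Import all_classical all_reals all_analysis.
From mathcomp Require Import complex.
Set Implicit Arguments. Unset Strict Implicit. Unset Printing Implicit Defensive.
Import Order.TTheory GRing.Theory Num.Theory.
Import numFieldTopology.Exports numFieldNormedType.Exports.
Local Open Scope classical_set_scope.
Local Open Scope ring_scope.

Section Defs.
Variables (R : realType) (d : nat).

Local Notation pt := 'rV[R]_d.
Local Notation C := R[i].

Definition cabs (z : C) : R := Num.sqrt (complex.Re z ^+ 2 + complex.Im z ^+ 2).
Definition cconj (z : C) : C := Complex (complex.Re z) (- complex.Im z).

Definition BorelRd := g_sigma_algebraType (@open pt).

Definition L2ip (rho : {measure set BorelRd -> \bar R}) (D : set pt)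
  (f g : pt -> C) : C :=
  Complex (Rintegral rho (D : set BorelRd) (fun x => complex.Re (f x * cconj (g x))))
          (Rintegral rho (D : set BorelRd) (fun x => complex.Im (f x * cconj (g x)))).

Definition ipnorm (ip : (pt -> C) -> (pt -> C) -> C) (f : pt -> C) : R :=
  Num.sqrt (complex.Re (ip f f)).

Definition ksec (D : set pt) (K : pt -> pt -> C) (x : pt) : pt -> C :=
  fun y => if y \in D then K y x else 0.

(* H (a set of functions D -> C, represented as functions on R^d vanishing
   outside D) with inner product ip is a reproducing kernel Hilbert space on D
   with reproducing kernel K. *)
Record is_RKHS (D : set pt) (K : pt -> pt -> C) (H : set (pt -> C))
    (ip : (pt -> C) -> (pt -> C) -> C) : Prop := {
  rkhs_supp : forall f, H f -> forall x, ~ D x -> f x = 0;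
  rkhs_zero : H (fun=> 0);
  rkhs_lin : forall (a : C) f g, H f -> H g -> H (fun x => a * f x + g x);
  rkhs_ip_lin : forall (a : C) f g h, H f -> H g -> H h ->
      ip (fun x => a * f x + g x) h = a * ip f h + ip g h;
  rkhs_ip_herm : forall f g, H f -> H g -> ip g f = cconj (ip f g);
  rkhs_ip_pos : forall f, H f -> 0 <= ip f f;
  rkhs_ip_def : forall f, H f -> ip f f = 0 -> f = (fun=> 0);
  rkhs_complete : forall u : nat -> pt -> C, (forall n, H (u n)) ->
      (forall e : R, 0 < e -> exists N, forall n k, (N <= n)%N -> (N <= k)%N ->
          ipnorm ip (fun x => u n x - u k x) < e) ->
      exists f, H f /\ forall e : R, 0 < e -> exists N, forall n, (N <= n)%N ->
          ipnorm ip (fun x => u n x - f x) < e;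
  rkhs_ksec : forall x, D x -> H (ksec D K x);
  rkhs_repr : forall x f, D x -> H f -> ip f (ksec D K x) = f x }.

Definition supdist (D : set pt) (f g : pt -> C) : \bar R :=
  ereal_sup [set (cabs (f x - g x))%:E | x in D].

Definition Linfty (D : set pt) (g : pt -> C) : Prop :=
  (exists B : R, forall x, D x -> cabs (g x) <= B) /\
  measurable_fun (D : set BorelRd) (fun x : BorelRd => complex.Re (g x)) /\
  measurable_fun (D : set BorelRd) (fun x : BorelRd => complex.Im (g x)).

Definition alg_error (D : set pt) (H : set (pt -> C))
    (ip : (pt -> C) -> (pt -> C) -> C) (n : nat) (xs : 'I_n -> pt)
    (phi : ('I_n -> C) -> pt -> C) : \bar R :=
  ereal_sup [set supdist D f (phi (fun i => f (xs i))) |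
             f in [set f | H f /\ ipnorm ip f <= 1]].

Definition sampling_number (D : set pt) (H : set (pt -> C))
    (ip : (pt -> C) -> (pt -> C) -> C) (n : nat) : \bar R :=
  ereal_inf [set e | exists (xs : 'I_n -> pt) (phi : ('I_n -> C) -> pt -> C),
     [/\ forall i, D (xs i), forall y, Linfty D (phi y) &
         e = alg_error D H ip xs phi]].

Definition kernel_continuous (D : set pt) (K : pt -> pt -> C) : Prop :=
  forall x y, D x -> D y -> forall e : R, 0 < e -> exists2 del : R, 0 < del &
    forall x' y', D x' -> D y' -> `|x - x'| < del -> `|y - y'| < del ->
      cabs (K x y - K x' y') < e.

Definition kernel_hermitian (D : set pt) (K : pt -> pt -> C) : Prop :=
  forall x y, D x -> D y -> K y x = cconj (K x y).

Definition kernel_posdef (D : set pt) (K : pt -> pt -> C) : Prop :=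
  forall n (xs : 'I_n -> pt) (a : 'I_n -> C), (forall i, D (xs i)) ->
    0 <= \sum_(i < n) \sum_(j < n) cconj (a i) * a j * K (xs i) (xs j).

Definition full_support (D : set pt) (rho : {measure set BorelRd -> \bar R}) : Prop :=
  forall U : set pt, open U -> D `&` U !=set0 -> (0 < rho ((D `&` U) : set BorelRd))%E.

Definition sigma (lam : nat -> R) (k : nat) : R := Num.sqrt (lam k).
Definition eta (lam : nat -> R) (e : nat -> pt -> C) (k : nat) : pt -> C :=
  fun x => Complex ((Num.sqrt (lam k))^-1) 0 * e k x.

Definition Nrho (D : set pt) (lam : nat -> R) (e : nat -> pt -> C) (m : nat) : \bar R :=
  ereal_sup [set (\sum_(1 <= k < m.+1) (cabs (eta lam e k x)) ^+ 2)%:E | x in D].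

End Defs.

(* Main.v *)
(* Write [K_x] for the reproducing kernel at [x], [t * I + G(X)] for the regularized
   Gram matrix of a point set [X], and let [tau] bound the squared norm of the part of
   [K_x] orthogonal to the first [m] basis vectors, uniformly in [x].  With
   [t = 16 * tau], choose [4 * m] points whose determinant [det (t * I + G(X))] is
   maximal up to a factor 2, and add an arbitrary point [x].  By Cramer's rule the
   diagonal entries of the inverse [C] of the enlarged matrix are ratios of minors to
   the determinant, so near-maximality makes the entry [C_xx] at least half of every
   other one.  On the other hand [tr (I - t * C)], the effective dimension of the point
   set at level [t], is small: the first [m] basis vectors contribute at most [m], the
   remainder at most a quarter of the number of points.  Hence [t * C_xx >= 1/4].  A
   function vanishing on [X] satisfies [|f x|^2 * C_xx <= |f|^2], so
   [|f x|^2 <= 64 * tau * |f|^2].  Returning any function of the unit ball that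
   interpolates the samples then has squared error at most [256 * tau].
   By Parseval, [tau] can be taken arbitrarily close to twice the second quantity of
   the maximum, bounding each eigenvalue [lam_k] by an average of the larger ones
   [lam_j], [k / 4 <= j <= k]. *)
Require Import Defs.
From HB Require Import structures.
From mathcomp Require Import all_boot all_order all_fingroup all_algebra.
From mathcomp Require Import all_classical all_reals all_analysis.
From mathcomp Require Import measurable_realfun complex ring lra zify.
Import Order.TTheory GRing.Theory Num.Theory.
Import numFieldTopology.Exports numFieldNormedType.Exports.
Local Open Scope classical_set_scope.
Local Open Scope ring_scope.
Set Implicit Arguments.
Unset Strict Implicit.
Unset Printing Implicit Defensive.

(** * Modulus and conjugation of complex numbers *)

Section ComplexNumbers.
Context {R : realType}.
Implicit Types z : R[i].

Lemma cconjE z : cconj z = z^*.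
Proof. by case: z. Qed.

Lemma normcE z : `|z| = (cabs z)%:C%C.
Proof. by rewrite normc_def. Qed.

Lemma cabs_ge0 z : 0 <= cabs z.
Proof. exact: sqrtr_ge0. Qed.

Lemma ge0_ReE z : 0 <= z -> (complex.Re z)%:C%C = z.
Proof. by move=> z0; apply: RRe_real; exact: ger0_real. Qed.

End ComplexNumbers.

(** * Reproducing kernel Hilbert spaces *)

Section RKHS.
Context {R : realType} {d : nat}.
Local Notation T := 'rV[R]_d.
Local Notation C := R[i].
Variables (D : set T) (K : T -> T -> C) (H : set (T -> C)).
Variable ip : (T -> C) -> (T -> C) -> C.
Hypothesis rk : is_RKHS D K H ip.
Implicit Types (f h : T -> C) (x y : T).

Definition lincomb {n} (w : 'I_n -> C) (g : 'I_n -> T -> C) : T -> C :=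
  fun x => \sum_(i < n) w i * g i x.

Lemma ip0l h : H h -> ip (fun=> 0) h = 0.
Proof.
move=> Hh; have H0 := rkhs_zero rk.
have := rkhs_ip_lin rk 1 H0 H0 Hh.
have -> : (fun x : T => 1 * (0 : C) + 0) = (fun=> 0).
  by apply/funext => x; rewrite mulr0 addr0.
by rewrite mul1r => /eqP; rewrite eq_sym -subr_eq0 addrK => /eqP.
Qed.

Lemma ip_conj f g : H f -> H g -> ip g f = (ip f g)^*.
Proof. by move=> Hf Hg; rewrite (rkhs_ip_herm rk) // cconjE. Qed.

Lemma ip0r h : H h -> ip h (fun=> 0) = 0.
Proof.
by move=> Hh; rewrite (ip_conj (rkhs_zero rk) Hh) ip0l // rmorph0.
Qed.

(** Both halves share one induction, because [rkhs_ip_lin] applies only to functions already known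
    to lie in [H]. *)
Lemma lincombP n (w : 'I_n -> C) g : (forall i, H (g i)) ->
  H (lincomb w g) /\
  forall h, H h -> ip (lincomb w g) h = \sum_(i < n) w i * ip (g i) h.
Proof.
elim: n w g => [|n IH] w g Hg.
  have -> : lincomb w g = fun=> 0 by apply/funext => x; rewrite /lincomb big_ord0.
  by split; [exact: rkhs_zero rk | move=> h Hh; rewrite big_ord0 ip0l].
have [Hs ips] := IH (w \o lift ord0) (g \o lift ord0) (fun i => Hg _).
have -> : lincomb w g =
    fun x => w ord0 * g ord0 x + lincomb (w \o lift ord0) (g \o lift ord0) x.
  by apply/funext => x; rewrite /lincomb big_ord_recl.
split; first exact: rkhs_lin rk _ _ _ (Hg _) Hs.
by move=> h Hh; rewrite (rkhs_ip_lin rk) // ips // big_ord_recl.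
Qed.

Lemma H_lincomb n (w : 'I_n -> C) g : (forall i, H (g i)) -> H (lincomb w g).
Proof. by move=> /(lincombP w)[]. Qed.

Lemma ip_lincombl n (w : 'I_n -> C) g h : (forall i, H (g i)) -> H h ->
  ip (lincomb w g) h = \sum_(i < n) w i * ip (g i) h.
Proof. by move=> /(lincombP w)[_]; apply. Qed.

Lemma ip_lincombr n (w : 'I_n -> C) g h : (forall i, H (g i)) -> H h ->
  ip h (lincomb w g) = \sum_(i < n) (w i)^* * ip h (g i).
Proof.
move=> Hg Hh; rewrite (ip_conj (H_lincomb w Hg) Hh) ip_lincombl // rmorph_sum.
by apply: eq_bigr => i _; rewrite rmorphM /= (ip_conj (Hg i) Hh).
Qed.

Lemma sub_lincombE f g :
  (fun x => f x - g x) = (fun x => (-1) * g x + f x).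
Proof. by apply/funext => x; rewrite mulN1r addrC. Qed.

Lemma H_sub f g : H f -> H g -> H (fun x => f x - g x).
Proof. by move=> Hf Hg; rewrite sub_lincombE; exact: rkhs_lin rk _ _ _ Hg Hf. Qed.

Lemma ip_subl f g h : H f -> H g -> H h ->
  ip (fun x => f x - g x) h = ip f h - ip g h.
Proof.
by move=> Hf Hg Hh; rewrite sub_lincombE (rkhs_ip_lin rk) // mulN1r addrC.
Qed.

Lemma ip_subr f g h : H f -> H g -> H h ->
  ip h (fun x => f x - g x) = ip h f - ip h g.
Proof.
move=> Hf Hg Hh; rewrite (ip_conj (H_sub Hf Hg) Hh) ip_subl // rmorphB /=.
by rewrite (ip_conj Hf Hh) (ip_conj Hg Hh).
Qed.

Lemma ip_ge0 f : H f -> 0 <= ip f f. Proof. by move=> Hf; apply: (rkhs_ip_pos rk). Qed.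

Lemma ip_sub_sub f h : H f -> H h ->
  ip (fun x => f x - h x) (fun x => f x - h x) =
  ip f f + ip h h - (ip h f + (ip h f)^*).
Proof.
move=> Hf Hh; have Hd := H_sub Hf Hh.
by rewrite ip_subl // !ip_subr // (ip_conj Hh Hf); ring.
Qed.

Lemma ip_real f : H f -> (ip f f)^* = ip f f.
Proof. by move=> /ip_ge0/ger0_real/CrealP. Qed.

Lemma cauchy_schwarz f g : H f -> H g -> `|ip f g| ^+ 2 <= ip f f * ip g g.
Proof.
move=> Hf Hg; have [g0|gn0] := eqVneq (ip g g) 0.
  by rewrite g0 mulr0 (rkhs_ip_def rk Hg g0) ip0r // normr0 expr0n.
have g_gt0 : 0 < ip g g by rewrite lt_def gn0 ip_ge0.
pose s := ip f g / ip g g.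
have Hs : H (fun x => s * g x).
  have -> : (fun x => s * g x) = lincomb (fun _ : 'I_1 => s) (fun _ => g).
    by apply/funext => x; rewrite /lincomb big_ord1.
  exact: H_lincomb.
have ips h : H h -> ip (fun x => s * g x) h = s * ip g h.
  move=> Hh; have -> : (fun x => s * g x) = fun x => s * g x + 0.
    by apply/funext => x; rewrite addr0.
  by rewrite (rkhs_ip_lin rk _ Hg (rkhs_zero rk) Hh) ip0l // addr0.
have := ip_ge0 (H_sub Hf Hs).
have orth : ip (fun x => f x - s * g x) g = 0.
  by rewrite ip_subl // ips // /s divfK // subrr.
have -> : ip (fun x => f x - s * g x) (fun x => f x - s * g x) =
    ip (fun x => f x - s * g x) f.
  rewrite [LHS]ip_subr //; last exact: H_sub.
  rewrite [X in _ - X](ip_conj Hs (H_sub Hf Hs)) ips; last exact: H_sub.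
  by rewrite (ip_conj (H_sub Hf Hs) Hg) orth conjC0 mulr0 conjC0 subr0.
rewrite ip_subl // ips // subr_ge0 (ip_conj Hf Hg) /s mulrAC -normCK.
by rewrite ler_pdivrMr.
Qed.

Lemma H_ksec x : D x -> H (ksec D K x). Proof. exact: rkhs_ksec rk x. Qed.

Lemma ksecE x y : D x -> ksec D K y x = K x y.
Proof. by move=> Dx; rewrite /ksec mem_set. Qed.

Lemma ip_ksec x y : D x -> D y -> ip (ksec D K x) (ksec D K y) = K y x.
Proof. by move=> Dx Dy; rewrite (rkhs_repr rk) ?ksecE //; exact: H_ksec. Qed.

Lemma eval_le f x : D x -> H f -> `|f x| ^+ 2 <= ip f f * K x x.
Proof.
move=> Dx Hf; rewrite -(rkhs_repr rk Dx Hf) -(ip_ksec Dx Dx).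
exact: cauchy_schwarz (H_ksec Dx).
Qed.

Lemma ksec_diag_ge0 x : D x -> 0 <= K x x.
Proof. by move=> Dx; rewrite -(ip_ksec Dx Dx); exact: ip_ge0 (H_ksec Dx). Qed.

(** * Projection of the kernel off a finite orthonormal family *)

Section Orthonormal.
Variables (m : nat) (E : 'I_m -> T -> C).
Hypotheses (HE : forall k, H (E k)) (onE : forall j k, ip (E j) (E k) = (j == k)%:R).

(** The squared distance from [ksec D K x] to the span of [E], by [ip_kres_self]. *)
Definition residual x := K x x - \sum_(k < m) `|E k x| ^+ 2.

(** By the reproducing property the coefficient of [ksec D K x] on [E k] is the conjugate of
    [E k x]. *)
Definition kres x : T -> C :=
  fun y => ksec D K x y - lincomb (fun k => (E k x)^*) E y.

Lemma H_kres x : D x -> H (kres x).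
Proof. by move=> Dx; apply: H_sub; [exact: H_ksec | exact: H_lincomb]. Qed.

Lemma ip_kres f x : D x -> H f ->
  ip f (kres x) = f x - \sum_(k < m) ip f (E k) * E k x.
Proof.
move=> Dx Hf; rewrite /kres ip_subr //; [|exact: H_ksec|exact: H_lincomb].
rewrite (rkhs_repr rk) // ip_lincombr //; congr (_ - _).
by apply: eq_bigr => k _; rewrite conjCK mulrC.
Qed.

Lemma ip_E_kres k x : D x -> ip (E k) (kres x) = 0.
Proof.
move=> Dx; rewrite ip_kres // (bigD1 k) //= onE eqxx mul1r big1 ?addr0 ?subrr //.
by move=> j jk; rewrite onE eq_sym (negbTE jk) mul0r.
Qed.

Lemma ip_kres_self x : D x -> ip (kres x) (kres x) = residual x.
Proof.
move=> Dx; have Hk := H_kres Dx; rewrite ip_kres // big1 ?subr0 => [|k _]; last first.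
  by rewrite (ip_conj (HE k) Hk) ip_E_kres // conjC0 mul0r.
rewrite /kres ksecE // /residual /lincomb; congr (_ - _).
by apply: eq_bigr => k _; rewrite -normCKC.
Qed.

Lemma residual_ge0 x : D x -> 0 <= residual x.
Proof. by move=> Dx; rewrite -ip_kres_self //; exact/ip_ge0/H_kres. Qed.

(** Pairing [f] with [kres x] evaluates at [x] the part of [f] orthogonal to [E]; then
    Cauchy-Schwarz applies. *)
Lemma eval_residual_le f x : D x -> H f ->
  `|f x - \sum_(k < m) ip f (E k) * E k x| ^+ 2 <= ip f f * residual x.
Proof.
move=> Dx Hf; rewrite -ip_kres // -ip_kres_self //.
exact/cauchy_schwarz/H_kres.
Qed.

End Orthonormal.

(** * Regularized Gram matrices *)

Section RegularizedGram.
Variable t : C.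
Hypothesis t_gt0 : 0 < t.

Definition gram n (z : 'I_n -> T) : 'M[C]_n :=
  \matrix_(i, j) (t *+ (i == j) + K (z i) (z j)).

Definition ksum n (z : 'I_n -> T) (w : 'cV[C]_n) : T -> C :=
  lincomb (fun i => w i 0) (fun i => ksec D K (z i)).

Section Points.
Variables (n : nat) (z : 'I_n -> T).
Hypothesis Dz : forall i, D (z i).
Implicit Types (w u : 'cV[C]_n) (i j : 'I_n).

Lemma H_ksum w : H (ksum z w).
Proof. by apply: H_lincomb => i; exact: H_ksec. Qed.

Lemma ip_ksum f w : H f -> ip f (ksum z w) = \sum_i (w i 0)^* * f (z i).
Proof.
move=> Hf; rewrite ip_lincombr // => [|i]; last exact: H_ksec.
by apply: eq_bigr => i _; rewrite (rkhs_repr rk).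
Qed.

Lemma gram_mulE w i : (gram z *m w) i 0 = t * w i 0 + ksum z w (z i).
Proof.
rewrite !mxE /ksum /lincomb (eq_bigr (fun j => (t *+ (i == j)) * w j 0 +
  w j 0 * ksec D K (z j) (z i))); last first.
  by move=> j _; rewrite mxE mulrDl ksecE // [w j 0 * _]mulrC.
rewrite big_split /= (bigD1 i) //= eqxx big1 ?addr0 // => j ji.
by rewrite eq_sym (negbTE ji) mul0r.
Qed.

(** The reproducing property turns the kernel part of the quadratic form into a squared norm. Both
    terms are nonnegative, which yields invertibility here and the positivity of the inverse's
    diagonal later. *)
Lemma gram_form w : \sum_i (w i 0)^* * (gram z *m w) i 0 =
  ip (ksum z w) (ksum z w) + t * \sum_i `|w i 0| ^+ 2.
Proof.
rewrite ip_ksum; last exact: H_ksum.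
rewrite mulr_sumr -big_split /=; apply: eq_bigr => i _.
by rewrite gram_mulE mulrDr addrC normCKC mulrCA.
Qed.

Lemma gram_unit : gram z \in unitmx.
Proof.
rewrite -unitmx_tr -row_free_unit -kermx_eq0; apply/rowV0P => v.
rewrite sub_kermx => /eqP vA.
have Av : gram z *m v^T = 0.
  by rewrite -[gram z]trmxK -trmx_mul vA trmx0.
have := gram_form v^T; rewrite Av big1 => [/esym/eqP|i _]; last by rewrite !mxE mulr0.
rewrite paddr_eq0; last 2 first.
- exact/ip_ge0/H_ksum.
- by apply: mulr_ge0 (ltW t_gt0) _; apply: sumr_ge0 => i _; rewrite exprn_ge0.
rewrite mulf_eq0 (gt_eqF t_gt0) //= => /andP[_]; rewrite psumr_eq0 => [/allP v0|i _]; last first.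
  by rewrite exprn_ge0.
apply/rowP => i; have := v0 i (mem_index_enum _).
by rewrite expf_eq0 normr_eq0 !mxE /= => /eqP.
Qed.

Let G := invmx (gram z).

Lemma gram_inv_form u : \sum_i ((G *m u) i 0)^* * u i 0 =
  ip (ksum z (G *m u)) (ksum z (G *m u)) + t * \sum_i `|(G *m u) i 0| ^+ 2.
Proof. by rewrite -gram_form mulmxA mulmxV ?gram_unit // mul1mx. Qed.

(** This is [gram_inv_form] at a unit vector. The conjugate goes away in [gram_inv_diagE], once the
    right-hand side has shown that the entry is real. *)
Lemma gram_inv_diag_conj j : (G j j)^* =
  ip (ksum z (col j G)) (ksum z (col j G)) + t * \sum_i `|G i j| ^+ 2.
Proof.
have := gram_inv_form (delta_mx j 0); rewrite -colE.
rewrite (bigD1 j) //= !mxE !eqxx mulr1 big1 ?addr0 => [->|i ij]; last first.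
  by rewrite !mxE (negbTE ij) mulr0.
by congr (_ + t * _); apply: eq_bigr => i _; rewrite mxE.
Qed.

Lemma gram_inv_diag_ge0 j : 0 <= G j j.
Proof.
rewrite -conjC_ge0 gram_inv_diag_conj addr_ge0 //; first exact/ip_ge0/H_ksum.
by apply: mulr_ge0 (ltW t_gt0) _; apply: sumr_ge0 => i _; rewrite exprn_ge0.
Qed.

Lemma gram_inv_diagE j : G j j =
  ip (ksum z (col j G)) (ksum z (col j G)) + t * \sum_i `|G i j| ^+ 2.
Proof.
by rewrite -gram_inv_diag_conj; apply/esym/CrealP/ger0_real/gram_inv_diag_ge0.
Qed.

Lemma norm_ksum_col_le j : ip (ksum z (col j G)) (ksum z (col j G)) <= G j j.
Proof.
rewrite [leRHS]gram_inv_diagE lerDl; apply: mulr_ge0 (ltW t_gt0) _.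
by apply: sumr_ge0 => i _; rewrite exprn_ge0.
Qed.

Lemma gram_inv_diag_gt0 j : 0 < G j j.
Proof.
rewrite lt_def gram_inv_diag_ge0 andbT; apply/eqP => Gjj0.
have := gram_inv_diagE j; rewrite Gjj0 => /esym/eqP; rewrite paddr_eq0; last 2 first.
- exact/ip_ge0/H_ksum.
- by apply: mulr_ge0 (ltW t_gt0) _; apply: sumr_ge0 => i _; rewrite exprn_ge0.
rewrite mulf_eq0 (gt_eqF t_gt0) //= => /andP[_]; rewrite psumr_eq0 => [/allP v0|i _]; last first.
  by rewrite exprn_ge0.
have Gj0 : col j G = 0.
  apply/colP => i; have := v0 i (mem_index_enum _).
  by rewrite expf_eq0 normr_eq0 !mxE /= => /eqP.
have : (gram z *m G) j j = 1 by rewrite mulmxV ?gram_unit // mxE eqxx.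
have -> : (gram z *m G) j j = (gram z *m col j G) j 0 
  by rewrite !mxE; apply: eq_bigr => i _; rewrite [col _ _ _ _]mxE.
by rewrite Gj0 mulmx0 mxE => /eqP; rewrite eq_sym oner_eq0.
Qed.

(** Keeping only the term [i = j] in [gram_inv_diagE] gives [t * G j j ^ 2 <= G j j]. *)
Lemma gram_inv_diag_le j : t * G j j <= 1.
Proof.
have Gj := gram_inv_diag_gt0 j.
rewrite -(ler_pM2r Gj) mul1r -mulrA -expr2.
rewrite [leRHS]gram_inv_diagE -[leLHS]add0r.
apply: lerD; first exact/ip_ge0/H_ksum.
rewrite ler_pM2l // (bigD1 j) //= (ger0_norm (ltW Gj)) lerDl.
by apply: sumr_ge0 => i _; rewrite exprn_ge0.
Qed.

(** These values are the diagonal of [I - t * G]; their sum over [j] is the effective dimension. *)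
Lemma ksum_col_diag j : ksum z (col j G) (z j) = 1 - t * G j j.
Proof.
have : (gram z *m col j G) j 0 = 1.
  by rewrite colE mulmxA mulmxV ?gram_unit // mul1mx !mxE !eqxx.
by rewrite gram_mulE mxE => <-; rewrite addrAC subrr add0r.
Qed.

(** Pairing [f] with the kernel sum of column [j] sees only [f (z j)], with weight [G j j]. That
    kernel sum has squared norm at most [G j j], so Cauchy-Schwarz leaves one factor [G j j] on the
    left. *)
Lemma eval_gram_inv_le f j : H f -> (forall i, i != j -> f (z i) = 0) ->
  `|f (z j)| ^+ 2 * G j j <= ip f f.
Proof.
move=> Hf f0; have Gj := gram_inv_diag_gt0 j.
have := cauchy_schwarz Hf (H_ksum (col j G)).
rewrite ip_ksum // (bigD1 j) //= big1 ?addr0 => [|i ij]; last by rewrite f0 // mulr0.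
rewrite mxE normrM norm_conjC (ger0_norm (ltW Gj)) exprMn mulrC expr2 mulrA.
move=> h; rewrite -(ler_pM2r Gj) (le_trans h) // ler_wpM2l ?ip_ge0 //.
exact: norm_ksum_col_le.
Qed.

End Points.

(** Cramer's rule: a diagonal cofactor has sign [(-1)^(j + j) = 1], and its minor is the Gram matrix
    without the point [z j]. *)
Lemma det_gram_minor n (z : 'I_n.+1 -> T) j : (forall i, D (z i)) ->
  \det (gram z) * invmx (gram z) j j = \det (gram (z \o lift j)).
Proof.
move=> Dz; have uz := gram_unit Dz.
rewrite /invmx uz !mxE mulrA divff ?mul1r; last by rewrite -unitfE -unitmxE.
rewrite /cofactor -signr_odd addnn odd_double expr0 mul1r.
by congr (\det _); apply/matrixP => a b; rewrite !mxE (inj_eq lift_inj).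
Qed.

Lemma det_gram_gt0 n (z : 'I_n -> T) : (forall i, D (z i)) -> 0 < \det (gram z).
Proof.
elim: n z => [|n IH] z Dz; first by rewrite det_mx00 ltr01.
have := IH (z \o lift ord0) (fun i => Dz _).
by rewrite -det_gram_minor // pmulr_lgt0 // gram_inv_diag_gt0.
Qed.

(** * Upper bound on the effective dimension of a point set *)

Section TraceBound.
Variables (m : nat) (E : 'I_m -> T -> C) (n : nat) (z : 'I_n -> T).
Hypotheses (HE : forall k, H (E k)) (onE : forall j k, ip (E j) (E k) = (j == k)%:R).
Hypothesis Dz : forall i, D (z i).
Hypothesis res_le : forall x, D x -> 16 * residual E x <= t.

Let G := invmx (gram z).

Let proj_trace k := \sum_j ip (ksum z (col j G)) (E k) * E k (z j).

(** Let [h] be the regularized fit to the values [E k (z j)] and [s] the trace. Then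
    [s = ip h (E k)] is real and dominates [ip h h], so Cauchy-Schwarz gives
    [s ^ 2 <= ip h h <= s]. *)
Let proj_traceP k : 0 <= proj_trace k <= 1.
Proof.
pose u : 'cV_n := \col_j E k (z j).
pose h := ksum z (G *m u).
have Hh : H h by exact: H_ksum.
have ipw w : ip (ksum z w) (E k) = \sum_i w i 0 * (E k (z i))^*.
  have Hw : H (ksum z w) by exact: H_ksum.
  rewrite (ip_conj (HE k) Hw) ip_ksum // rmorph_sum; apply: eq_bigr => i _.
  by rewrite rmorphM /= conjCK.
have sE : proj_trace k = ip h (E k).
  rewrite /h ipw; under eq_bigr do rewrite mxE mulr_suml.
  rewrite exchange_big; apply: eq_bigr => j _; rewrite ipw mulr_suml.
  by apply: eq_bigr => i _; rewrite !mxE mulrAC.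
have sJ : (proj_trace k)^* = ip h h + t * \sum_i `|(G *m u) i 0| ^+ 2.
  rewrite -gram_inv_form // sE /h ipw rmorph_sum; apply: eq_bigr => i _.
  by rewrite rmorphM /= conjCK [u i 0]mxE.
have t0 : 0 <= t * \sum_i `|(G *m u) i 0| ^+ 2.
  by apply: mulr_ge0 (ltW t_gt0) _; apply: sumr_ge0 => i _; rewrite exprn_ge0.
have s0 : 0 <= proj_trace k by rewrite -conjC_ge0 sJ addr_ge0 ?ip_ge0.
have h_le : ip h h <= proj_trace k.
  have /CrealP <- : proj_trace k \is Num.real by exact: ger0_real.
  by rewrite sJ lerDl.
rewrite s0 /=.
have := cauchy_schwarz Hh (HE k); rewrite -sE onE eqxx mulr1 ger0_norm // => le2.
have [->|sn0] := eqVneq (proj_trace k) 0; first exact: ler01.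
have s_gt0 : 0 < proj_trace k by rewrite lt_def sn0.
by rewrite -(ler_pM2r s_gt0) mul1r -expr2 (le_trans le2).
Qed.

(** The squared tail is at most [G j j] times the residual, hence at most [t * G j j / 16 <= 1/16].
    This fixes the factor 16 in [res_le]. *)
Let tail_le j : `|ksum z (col j G) (z j) -
    \sum_(k < m) ip (ksum z (col j G)) (E k) * E k (z j)| <= 4^-1.
Proof.
rewrite -(@ler_pXn2r _ 2) ?nnegrE ?invr_ge0 ?ler0n //.
have Hh : H (ksum z (col j G)) by exact: H_ksum.
rewrite (le_trans (eval_residual_le HE onE (Dz j) Hh)) //.
rewrite exprVn -natrX -(@ler_pM2l _ 16) ?ltr0n // divff ?pnatr_eq0 //.
rewrite mulrCA (le_trans _ (gram_inv_diag_le Dz j)) // mulrC.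
apply: ler_pM; rewrite ?ip_ge0 ?mulr_ge0 ?ler0n ?(residual_ge0 HE onE) //.
  exact: res_le.
exact: norm_ksum_col_le.
Qed.

(** Each diagonal value splits into its projection on [E] and a tail: every basis function costs at
    most 1, every point at most 1/4. *)
Lemma gram_inv_trace_ge : n%:R - t * \sum_j G j j <= m%:R + n%:R / 4.
Proof.
have -> : n%:R - t * \sum_j G j j = \sum_j ksum z (col j G) (z j).
  under [RHS]eq_bigr => j _ do rewrite ksum_col_diag //.
  rewrite mulr_sumr.
  by rewrite sumrB sumr_const card_ord.
have -> : \sum_j ksum z (col j G) (z j) = \sum_k proj_trace k +
    \sum_j (ksum z (col j G) (z j) -
      \sum_(k < m) ip (ksum z (col j G)) (E k) * E k (z j)).
  by rewrite sumrB [X in _ - X]exchange_big addrC subrK.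
apply: lerD.
  have -> : m%:R = \sum_(k < m) 1 :> C by rewrite sumr_const card_ord.
  by apply: ler_sum => k _; have /andP[] := proj_traceP k.
apply: le_trans (real_ler_norm _) _.
  rewrite sumrB [X in _ - X]exchange_big rpredB //; apply: rpred_sum => i _.
    by rewrite ksum_col_diag // rpredB ?rpred1 // rpredM // gtr0_real // gram_inv_diag_gt0.
  by apply: ger0_real; have /andP[] := proj_traceP i.
apply: le_trans (ler_norm_sum _ _ _) _.
have -> : n%:R / 4 = \sum_(j < n) 4^-1 :> C by rewrite sumr_const card_ord mulr_natl.
by apply: ler_sum => j _; exact: tail_le.
Qed.

End TraceBound.

(** * Point sets of nearly maximal determinant *)

Lemma kernel_norm_le (b : C) x y : (forall x, D x -> K x x <= b) ->
  D x -> D y -> `|K x y| <= b.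
Proof.
move=> Kb Dx Dy; have b0 : 0 <= b := le_trans (ksec_diag_ge0 Dx) (Kb _ Dx).
rewrite -(@ler_pXn2r _ 2) ?nnegrE // -ip_ksec //.
rewrite (le_trans (cauchy_schwarz (H_ksec Dy) (H_ksec Dx))) // !ip_ksec //.
by rewrite expr2; apply: ler_pM; rewrite ?ksec_diag_ge0 ?Kb.
Qed.

(** A crude bound on the Leibniz expansion, enough to make the supremum of the determinants
    finite. *)
Lemma det_gram_le (b : C) n (z : 'I_n -> T) : (forall x, D x -> K x x <= b) ->
  (forall i, D (z i)) -> \det (gram z) <= (t + b) ^+ n *+ n`!.
Proof.
move=> Kb Dz; rewrite -[leLHS]ger0_norm ?(ltW (det_gram_gt0 Dz)) //.
apply: le_trans (ler_norm_sum _ _ _) _.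
rewrite -card_Sn -sumr_const; apply: ler_sum => s _.
rewrite normrM normr_sign mul1r normr_prod -[n in _ ^+ n]card_ord -prodr_const.
apply: ler_prod => i _; rewrite normr_ge0 mxE /= (le_trans (ler_normD _ _)) //.
apply: lerD; last exact: kernel_norm_le.
by case: eqP => _; rewrite ?normr0 ?(ltW t_gt0) // gtr0_norm.
Qed.

Lemma near_optimal_points n x0 : D x0 -> (exists b : C, forall x, D x -> K x x <= b) ->
  exists2 X : 'I_n -> T, forall i, D (X i) &
    forall Y : 'I_n -> T, (forall i, D (Y i)) ->
      \det (gram Y) <= 2 * \det (gram X).
Proof.
move=> Dx0 [b Kb].
pose S : set R := [set complex.Re (\det (gram Y)) | Y in [set Y : 'I_n -> T | forall i, D (Y i)]].
have ReS (Y : 'I_n -> T) : (forall i, D (Y i)) -> S (complex.Re (\det (gram Y))).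
  by move=> DY; exists Y.
have supS : has_sup S.
  split; first by exists (complex.Re (\det (gram (fun _ : 'I_n => x0)))); exact: ReS.
  exists (complex.Re ((t + b) ^+ n *+ n`!)) => _ [Y DY <-].
  by have := det_gram_le Kb DY; rewrite lecE => /andP[].
have Re_gt0 (Y : 'I_n -> T) : (forall i, D (Y i)) -> 0 < complex.Re (\det (gram Y)).
  by move=> /det_gram_gt0; rewrite ltcE => /andP[].
have sup_gt0 : 0 < sup S.
  apply: lt_le_trans (Re_gt0 (fun _ => x0) (fun=> Dx0)) _.
  by apply: (ub_le_sup supS.2); exact: ReS.
(* A margin of half the positive supremum gives the factor 2, so the supremum need not be
   attained. *)
have [_ [X DX <-] ltX] := sup_adherent (divr_gt0 sup_gt0 (ltr0n _ 2)) supS.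
exists X => // Y DY.
have YX : complex.Re (\det (gram Y)) <= 2 * complex.Re (\det (gram X)).
  apply: (le_trans (ub_le_sup supS.2 (ReS _ DY))).
  move: ltX; lra.
rewrite -(ge0_ReE (ltW (det_gram_gt0 DX))) -(ge0_ReE (ltW (det_gram_gt0 DY))).
by rewrite -[2]/(2%:R) -(rmorph_nat (real_complex R)) -rmorphM lecR.
Qed.

Lemma vanishing_eval_le m (E : 'I_m -> T -> C) (X : 'I_(4 * m) -> T) f x :
  (forall k, H (E k)) -> (forall j k, ip (E j) (E k) = (j == k)%:R) ->
  (forall x, D x -> 16 * residual E x <= t) ->
  (forall i, D (X i)) ->
  (forall Y : 'I_(4 * m) -> T, (forall i, D (Y i)) -> \det (gram Y) <= 2 * \det (gram X)) ->
  D x -> H f -> (forall i, f (X i) = 0) -> `|f x| ^+ 2 <= 4 * t * ip f f.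
Proof.
move=> HE onE res_le DX maxX Dx Hf fX.
pose z (i : 'I_(4 * m).+1) := if unlift ord0 i is Some j then X j else x.
have z0 : z ord0 = x by rewrite /z unlift_none.
have zl j : z (lift ord0 j) = X j by rewrite /z liftK.
have Dz i : D (z i) by rewrite /z; case: unliftP => [j|] _.
set c := invmx (gram z) ord0 ord0.
have zX : z \o lift ord0 = X by apply/funext => j /=.
(* Dropping any point of [z] leaves [4 * m] points, and dropping [x] leaves [X]; so near-maximality
   of [X] compares the two minors. *)
have diag_le j : invmx (gram z) j j <= 2 * c.
  rewrite -(ler_pM2l (det_gram_gt0 Dz)) det_gram_minor // mulrCA det_gram_minor // zX.
  by apply: maxX => i; exact: Dz.
(* With [N = 4 * m + 1] points and [m <= N / 4], the trace bound reads
   [N <= N / 4 + N / 4 + 2 * N * (t * c)]. *)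
have tc : 4^-1 <= t * c.
  have := gram_inv_trace_ge HE onE Dz res_le.
  rewrite lerBlDr => tr; set N : C := (4 * m).+1%:R in tr.
  have N0 : 0 < N by rewrite ltr0n.
  have mN : m%:R <= N * 4^-1.
    by rewrite ler_pdivlMr ?ltr0n // /N -natrM ler_nat mulnC leqnSn.
  have sumN : t * \sum_j invmx (gram z) j j <= N * (2 * (t * c)).
    rewrite [N * _](_ : _ = t * (N * (2 * c))); last by ring.
    rewrite ler_pM2l //; apply: le_trans (ler_sum _ (fun j _ => diag_le j)) _.
    by rewrite sumr_const card_ord -[leLHS]mulr_natl.
  have := le_trans tr (lerD (lerD mN (lexx (N / 4))) sumN).
  rewrite -!mulrDr -[leLHS]mulr1 ler_pM2l // -lerBlDl.
  rewrite (_ : 1 - _ = 2 * 4^-1); last by field.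
  by rewrite ler_pM2l.
have := eval_gram_inv_le Dz Hf (j := ord0); rewrite z0 => fx.
have {}fx : `|f x| ^+ 2 * c <= ip f f.
  apply: fx => i; case: (unliftP ord0 i) => [j ->|-> /eqP//] _.
  by rewrite zl.
apply: le_trans (_ : `|f x| ^+ 2 * (4 * (t * c)) <= _).
  rewrite ler_peMr ?exprn_ge0 //; move: tc.
  by rewrite -(@ler_pM2l _ 4) ?ltr0n // divff ?pnatr_eq0.
rewrite [leLHS](_ : _ = 4 * t * (`|f x| ^+ 2 * c)); last by ring.
by rewrite ler_pM2l // mulr_gt0.
Qed.

End RegularizedGram.

Lemma measurable_fun_of_continuous (g : T -> R) : compact D ->
  (forall x, D x -> forall e : R, 0 < e -> exists2 del : R, 0 < del &
    forall y, D y -> `|x - y| < del -> `|g x - g y| < e) ->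
  measurable_fun (D : set (BorelRd R d)) (g : BorelRd R d -> R).
Proof.
move=> cptD cg; have open_meas (U : set T) : open U -> measurable (U : set (BorelRd R d)).
  by move=> oU; apply: sub_sigma_algebra.
have mD : measurable (D : set (BorelRd R d)).
  rewrite -[D]setCK; apply: measurableC; apply: open_meas; rewrite openC.
  by apply: compact_closed => //; exact: norm_hausdorff.
move=> _; apply: (measurability _ (RGenOInfty.measurableE R)) => //.
move=> /= _ [_ [a ->] <-]; rewrite preimage_itvoy.
(* Continuity holds only relative to [D], so the complement of [D] is added before taking the
   interior. *)
rewrite (_ : _ `&` _ = D `&` interior (~` D `|` [set x | a < g x])); last first.
  apply/seteqP; split=> x [Dx] /=; last by move=> /interior_subset[].
  move=> agx; split=> //; have [del del0 cgx] := cg _ Dx _ (eqbRL (subr_gt0 _ _) agx).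
  rewrite /interior; apply/nbhs_ballP; exists del => // y; rewrite -ball_normE /= => xy.
  have [Dy|] := pselect (D y); last by left.
  by right; move: (cgx _ Dy xy); rewrite ltr_norml /=; lra.
by apply: measurableI => //; apply: open_meas; exact: open_interior.
Qed.

(** * Bounding the sampling number *)

Section Continuity.
Hypotheses (cptD : compact D) (contK : kernel_continuous D K).

Lemma H_continuous f x : H f -> D x -> forall e : R, 0 < e ->
  exists2 del : R, 0 < del &
    forall y, D y -> `|x - y| < del -> cabs (f x - f y) < e.
Proof.
move=> Hf Dx e e0; pose F := complex.Re (ip f f).
have F0 : 0 <= F by have := ip_ge0 Hf; rewrite lecE => /andP[].
(* The squared norm of the difference of kernel sections is a combination of three kernel
   differences, whence the 3. Using [F + 1] avoids division by zero and makes
   [F * (3 * e') < e ^+ 2]. *)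
pose e' := e ^+ 2 / (3 * (F + 1)).
have F1 : 0 < F + 1 by lra.
have e'0 : 0 < e' by rewrite divr_gt0 ?exprn_gt0 // mulr_gt0.
have [del del0 Kdel] := contK Dx Dx e'0; exists del => // y Dy xy.
have xx : `|x - x| < del by rewrite subrr normr0.
have Hx := H_ksec Dx; have Hy := H_ksec Dy; have Hd := H_sub Hx Hy.
have fxy : f x - f y = ip f (fun u => ksec D K x u - ksec D K y u).
  by rewrite ip_subr // !(rkhs_repr rk).
have gE : ip (fun u => ksec D K x u - ksec D K y u) (fun u => ksec D K x u - ksec D K y u)
    = (K x x - K x y) + (K x x - K y x) - (K x x - K y y).
  by rewrite ip_subl // !ip_subr // !ip_ksec //; ring.
have := cauchy_schwarz Hf Hd; rewrite -fxy gE => le_fxy.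
have dist_lt : `|(K x x - K x y) + (K x x - K y x) - (K x x - K y y)| < (3 * e')%:C%C.
  have close u v : D u -> D v -> `|x - u| < del -> `|x - v| < del ->
      `|K x x - K u v| < e'%:C%C.
    by move=> Du Dv xu xv; rewrite normcE ltcR; exact: Kdel.
  rewrite (le_lt_trans (ler_normB _ _)) //.
  have -> : (3 * e')%:C%C = e'%:C%C + e'%:C%C + e'%:C%C.
    by rewrite -!rmorphD /=; congr (_%:C%C); ring.
  apply: ltrD; last exact: close.
  by apply: le_lt_trans (ler_normD _ _) _; apply: ltrD; exact: close.
have fe : `|f x - f y| ^+ 2 < (e ^+ 2)%:C%C.
  apply: le_lt_trans le_fxy _; rewrite -(ge0_ReE (ip_ge0 Hf)) -/F.
  apply: (@le_lt_trans _ _ (F%:C%C * (3 * e')%:C%C)).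
    rewrite ler_wpM2l ?ler0c // (le_trans (real_ler_norm _)) ?ltW //.
    by rewrite -gE; exact/ger0_real/ip_ge0.
  rewrite -rmorphM ltcR /e' invfM mulrA.
  rewrite [ltLHS](_ : _ = e ^+ 2 * (F / (F + 1))); last by field; rewrite gt_eqF.
  by rewrite gtr_pMr ?exprn_gt0 // ltr_pdivrMr // mul1r ltrDl.
move: fe; rewrite normcE -rmorphXn ltcR ltr_pXn2r ?nnegrE ?cabs_ge0 //.
exact: ltW.
Qed.

(** Makes reconstructions taken from [H] admissible outputs of an algorithm. *)
Lemma Linfty_H (b : C) f : (forall x, D x -> K x x <= b) -> H f -> Linfty D f.
Proof.
move=> Kb Hf; split; [|split].
- exists (Num.sqrt (complex.Re (ip f f * b))) => x Dx.
  rewrite /cabs ler_wsqrtr // -lecR add_Re2_Im2.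
  have le1 : `|f x| ^+ 2 <= ip f f * b.
    by rewrite (le_trans (eval_le Dx Hf)) // ler_wpM2l ?ip_ge0 ?Kb.
  by rewrite ge0_ReE // (le_trans _ le1) // exprn_ge0.
- apply: measurable_fun_of_continuous => // x Dx e e0.
  have [del del0 fdel] := H_continuous Hf Dx e0; exists del => // y Dy xy.
  apply: le_lt_trans (fdel y Dy xy); rewrite /cabs raddfB -sqrtr_sqr.
  by rewrite ler_wsqrtr // lerDl sqr_ge0.
- apply: measurable_fun_of_continuous => // x Dx e e0.
  have [del del0 fdel] := H_continuous Hf Dx e0; exists del => // y Dy xy.
  apply: le_lt_trans (fdel y Dy xy); rewrite /cabs (raddfB (@complex.Im R : Rcomplex R -> R)) -sqrtr_sqr.
  by rewrite ler_wsqrtr // lerDr sqr_ge0.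
Qed.

Lemma ipnorm_le1 f : H f -> ipnorm ip f <= 1 -> ip f f <= 1.
Proof.
move=> Hf; rewrite /ipnorm => f1; rewrite -(ge0_ReE (ip_ge0 Hf)).
have f0 := ip_ge0 Hf; rewrite lecE in f0; have /andP[_ {}f0] := f0.
rewrite -[1]/(1%:C%C) lecR -(sqr_sqrtr f0) -[leRHS](expr1n _ 2).
by rewrite ler_pXn2r ?nnegrE ?sqrtr_ge0.
Qed.

Lemma ip_sub_le4 f g : H f -> H g -> ip f f <= 1 -> ip g g <= 1 ->
  ip (fun x => f x - g x) (fun x => f x - g x) <= 4.
Proof.
move=> Hf Hg f1 g1.
have c1 : `|ip g f| <= 1.
  rewrite -(@ler_pXn2r _ 2) ?nnegrE // expr1n (le_trans (cauchy_schwarz Hg Hf)) //.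
  by rewrite -[leRHS]mulr1; apply: ler_pM; rewrite ?ip_ge0.
rewrite ip_sub_sub // (_ : 4 = (1 + 1) + (1 + 1)); last by ring.
apply: lerD; first exact: lerD.
apply: le_trans (real_ler_norm _) _.
  by rewrite rpredN CrealE rmorphD /= conjCK addrC.
by rewrite normrN (le_trans (ler_normD _ _)) // norm_conjC lerD.
Qed.

Lemma sampling_number_ge0 n x0 : D x0 -> (0 <= sampling_number D H ip n)%E.
Proof.
move=> Dx0; apply: le_ereal_inf_tmp => _ [xs [phi [_ _ ->]]].
apply: (@le_trans _ _ (supdist D (fun=> 0) (phi (fun=> 0)))).
  apply: (@le_trans _ _ (cabs (0 - phi (fun=> 0) x0))%:E); first by rewrite lee_fin cabs_ge0.
  by apply: ereal_sup_ubound; exists x0.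
apply: ereal_sup_ubound; exists (fun=> 0) => //=; split; first exact: rkhs_zero rk.
by rewrite /ipnorm ip0l ?sqrtr0 //; exact: rkhs_zero rk.
Qed.

Lemma sampling_number_sqr_le m (E : 'I_m -> T -> C) (tau : R) x0 :
  (exists b : C, forall x, D x -> K x x <= b) -> D x0 ->
  (forall k, H (E k)) -> (forall j k, ip (E j) (E k) = (j == k)%:R) ->
  0 < tau -> (forall x, D x -> residual E x <= tau%:C%C) ->
  (sampling_number D H ip (4 * m) * sampling_number D H ip (4 * m)
    <= (256 * tau)%:E)%E.
Proof.
move=> exb Dx0 HE onE tau0 res_le.
pose t : C := (16 * tau)%:C%C.
have t0 : 0 < t by rewrite ltcR; lra.
have res_le' x : D x -> 16 * residual E x <= t.
  move=> Dx; rewrite /t rmorphM /= rmorph_nat ler_pM2l ?ltr0n //; exact: res_le.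
have [X DX maxX] := near_optimal_points t0 (4 * m) Dx0 exb.
(* Here [256 = 4 * 16 * 4]: the constant of [vanishing_eval_le], the ratio of [t] to [tau], and the
   bound of [ip_sub_le4]. *)
pose r := Num.sqrt (256 * tau).
have rr : r * r = 256 * tau by rewrite -expr2 sqr_sqrtr; lra.
pose good (v : 'I_(4 * m) -> C) := [set g | [/\ H g, ipnorm ip g <= 1 & forall i, g (X i) = v i]].
(* Data that no function of the unit ball produces are sent to the zero function, which also lies in
   [H]. *)
pose phi (v : 'I_(4 * m) -> C) : T -> C := xget (fun=> 0) (good v).
have le_r : (sampling_number D H ip (4 * m) <= r%:E)%E.
  apply: (@le_trans _ _ (alg_error D H ip X phi)).
    apply: ereal_inf_lbound; exists X, phi; split=> // v.
    have [b Kb] := exb; rewrite /phi; case: xgetP => [g _ [Hg _ _]|_].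
      exact: Linfty_H Kb Hg.
    exact: Linfty_H Kb (rkhs_zero rk).
  apply: ge_ereal_sup => _ [f [Hf f1] <-].
  have [Hg g1 gX] : good (fun i => f (X i)) (phi (fun i => f (X i))).
    by apply: (@xgetI _ _ (good _) f); split.
  apply: ge_ereal_sup => _ [x Dx <-]; rewrite lee_fin.
  have := vanishing_eval_le t0 HE onE res_le' DX maxX Dx (H_sub Hf Hg).
  move=> fx; rewrite /cabs ler_wsqrtr // -lecR add_Re2_Im2.
  apply: le_trans (fx _) _ => [i|]; first by rewrite gX subrr.
  apply: (@le_trans _ _ (4 * t * 4)).
    by rewrite ler_wpM2l ?mulr_ge0 ?(ltW t0) // ip_sub_le4 // ipnorm_le1.
  rewrite /t -(rmorph_nat (real_complex R)) -!rmorphM lecR; lra.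
have s0 := sampling_number_ge0 (4 * m) Dx0.
by rewrite -rr EFinM; apply: lee_pmul.
Qed.

End Continuity.

(** * Parseval and the tail of the kernel *)

Section Parseval.
Variable e : nat -> T -> C.
Hypothesis He : forall k, (0 < k)%N -> H (e k).
Hypothesis orthonormal_e : forall j k, (0 < j)%N -> (0 < k)%N -> ip (e j) (e k) = (j == k)%:R.
Hypothesis complete_e : forall f, H f ->
  (forall k, (0 < k)%N -> ip f (e k) = 0) -> f = (fun=> 0).

(** The shift matches ordinals, which start at 0, with eigenfunctions numbered from 1. *)
Definition first_basis n : 'I_n -> T -> C := fun k => e k.+1.

Lemma H_first_basis n (k : 'I_n) : H (first_basis k). Proof. exact: He. Qed.

Lemma first_basis_orthonormal n (j k : 'I_n) :
  ip (first_basis j) (first_basis k) = (j == k)%:R.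
Proof. by rewrite orthonormal_e. Qed.

Local Notation res n x := (residual (@first_basis n) x).
Local Notation kr n x := (kres (@first_basis n) x).

Lemma H_kr n x : D x -> H (kr n x).
Proof. by move=> Dx; apply: H_kres Dx => k; exact: H_first_basis. Qed.

Lemma ip_kr_self n x : D x -> ip (kr n x) (kr n x) = res n x.
Proof. exact (ip_kres_self (@H_first_basis n) (@first_basis_orthonormal n) (x := x)). Qed.

Lemma ip_kr_basis n j x : D x -> (0 < j <= n)%N -> ip (kr n x) (e j) = 0.
Proof.
move=> Dx /andP[j0 jn]; have jn' : (j.-1 < n)%N by rewrite prednK.
rewrite (ip_conj (He j0) (H_kr n Dx)) -(prednK j0).
have /= := ip_E_kres (@H_first_basis n) (@first_basis_orthonormal n) (Ordinal jn') Dx.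
by rewrite /first_basis /= => ->; rewrite conjC0.
Qed.

(** Pythagoras: for [k <= n], pairing [kr n x] with [kr k x] gives the value of [kr n x] at [x],
    which is [res n x]. *)
Lemma ip_kr_nested k n x : D x -> (k <= n)%N ->
  ip (fun y => kr k x y - kr n x y) (fun y => kr k x y - kr n x y) = res k x - res n x.
Proof.
move=> Dx kn; have [Hk Hn] := (H_kr k Dx, H_kr n Dx).
have nk : ip (kr n x) (kr k x) = res n x.
  rewrite (ip_kres (@H_first_basis k)) // big1 ?subr0 => [|j _]; last first.
    by rewrite /first_basis ip_kr_basis ?mul0r // (leq_trans (ltn_ord j)).
  rewrite -(ip_kr_self n Dx) (ip_kres (@H_first_basis n)) // big1 ?subr0 // => j _.
  by rewrite /first_basis ip_kr_basis ?mul0r // ltn_ord.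
have res_real : (res n x)^* = res n x.
  by rewrite -ip_kr_self // ip_real.
by rewrite (ip_sub_sub Hk Hn) nk !ip_kr_self // res_real; ring.
Qed.

Lemma ip_sub_swap f h : H f -> H h ->
  ip (fun x => f x - h x) (fun x => f x - h x) =
  ip (fun x => h x - f x) (fun x => h x - f x).
Proof.
by move=> Hf Hh; rewrite !ip_sub_sub // (ip_conj Hf Hh) conjCK; ring.
Qed.

(** The residuals decrease and are bounded below, so the partial expansions [u n] of the kernel
    section are Cauchy. Their limit has the same coefficients as the section, and completeness of
    the basis identifies the two. *)
Lemma residual_to0 x : D x -> forall eps : R, 0 < eps ->
  exists N, forall n, (N <= n)%N -> complex.Re (res n x) < eps.
Proof.
move=> Dx; pose u n : T -> C := lincomb (fun k => (first_basis k x)^*) (@first_basis n).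
have Hu n : H (u n) by apply: H_lincomb => k; exact: H_first_basis.
have krE n : kr n x = fun y => ksec D K x y - u n y by [].
pose r n := complex.Re (res n x).
have r0 n : 0 <= r n.
  by have := ip_ge0 (H_kr n Dx); rewrite ip_kr_self // lecE => /andP[].
have uu k n : (k <= n)%N ->
    complex.Re (ip (fun y => u n y - u k y) (fun y => u n y - u k y)) = r k - r n.
  move=> kn; rewrite -raddfB -(ip_kr_nested Dx kn).
  by congr (complex.Re (ip _ _)); apply/funext => y; rewrite !krE; ring.
have r_le k n : (k <= n)%N -> r n <= r k.
  move=> kn; rewrite -subr_ge0 -uu //.
  by have := ip_ge0 (H_sub (Hu n) (Hu k)); rewrite lecE => /andP[].
have infr : has_inf (range r) by split; [exists (r 0%N), 0%N | exists 0 => _ [n _ <-]].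
have cauchy eps : 0 < eps -> exists N, forall n k, (N <= n)%N -> (N <= k)%N ->
    ipnorm ip (fun y => u n y - u k y) < eps.
  move=> eps0; have [_ [N _ <-] ltN] := inf_adherent (exprn_gt0 2 eps0) infr.
  have small n k : (k <= n)%N -> (N <= k)%N -> r k - r n < eps ^+ 2.
    move=> kn Nk; have := r_le _ _ Nk; have : inf (range r) <= r n.
      by apply: (ge_inf infr.2); exists n.
    by move: ltN; lra.
  exists N => n k Nn Nk; rewrite /ipnorm -[ltRHS]gtr0_norm // -sqrtr_sqr.
  rewrite ltr_sqrt ?exprn_gt0 //; case/orP: (leq_total k n) => kn.
    by rewrite uu // small.
  by rewrite ip_sub_swap // uu // small.
have [f [Hf fu]] := rkhs_complete rk Hu cauchy.
have fE : (fun y => ksec D K x y - f y) = fun=> 0.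
  apply: complete_e => [|k k0]; first by apply: H_sub => //; exact: H_ksec.
  have Hkx : H (ksec D K x) by exact: H_ksec.
  apply/eqP/negPn/negP => ip_n0.
  have c0 : 0 < cabs (ip (fun y => ksec D K x y - f y) (e k)).
    by rewrite -ltcR -normcE normr_gt0.
  (* Taking [n >= k] makes the coefficients on [e k] of [u n] and of the section agree;
     Cauchy-Schwarz then contradicts the choice of [N]. *)
  have [N fN] := fu _ c0; pose n := maxn N k.
  have := fN n (leq_maxl _ _); rewrite ltNge => /negP; apply.
  have uk : ip (fun y => ksec D K x y - f y) (e k) = ip (fun y => u n y - f y) (e k).
    have := ip_kr_basis Dx (n := n) (j := k); rewrite k0 leq_maxr => /(_ isT).
    rewrite krE !ip_subl //; try exact: He.
    by move=> /eqP; rewrite subr_eq0 => /eqP ->.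
  have Hd := H_sub (Hu n) Hf; have He_k := He k0.
  rewrite uk /ipnorm /cabs ler_wsqrtr // -lecR add_Re2_Im2 ge0_ReE ?ip_ge0 //.
  by have := cauchy_schwarz Hd He_k; rewrite orthonormal_e // eqxx mulr1.
move=> eps eps0.
have seps : 0 < Num.sqrt eps by rewrite sqrtr_gt0.
have [N fN] := fu _ seps; exists N => n /fN.
have -> : (fun y => u n y - f y) = fun y => u n y - ksec D K x y.
  apply/funext => y; congr (_ - _); apply/esym/eqP.
  by rewrite -subr_eq0; apply/eqP; exact: (congr1 (@^~ y) fE).
rewrite /ipnorm ip_sub_swap //; last exact: H_ksec.
by rewrite -krE ip_kr_self // ltr_sqrt.
Qed.

(** The residuals at [m] and [N] differ by a finite sum, and the residual at [N] tends to 0. *)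
Lemma residual_le_tail m x (S : R) : D x ->
  (forall N, \sum_(m.+1 <= k < N.+1) (cabs (e k x)) ^+ 2 <= S) ->
  res m x <= S%:C%C.
Proof.
move=> Dx leS; have rE n : res n x = (complex.Re (res n x))%:C%C.
  by rewrite ge0_ReE // -ip_kr_self //; exact/ip_ge0/H_kr.
rewrite rE lecR; apply/ler_addgt0Pr => eps eps0.
have [N0 resN] := residual_to0 Dx eps0; pose N := maxn m N0.
have mN : (m <= N)%N by rewrite leq_maxl.
have -> : complex.Re (res m x) = complex.Re (res N x) +
    \sum_(m.+1 <= k < N.+1) (cabs (e k x)) ^+ 2.
  have : res m x = res N x + (\sum_(m.+1 <= k < N.+1) (cabs (e k x)) ^+ 2)%:C%C.
    have -> : (\sum_(m.+1 <= k < N.+1) (cabs (e k x)) ^+ 2)%:C%C =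
        \sum_(m <= k < N) `|e k.+1 x| ^+ 2.
      by rewrite big_add1 rmorph_sum; apply: eq_bigr => k _; rewrite normcE -rmorphXn.
    rewrite /residual /first_basis -!(big_mkord xpredT (fun k => `|e k.+1 x| ^+ 2)).
    by rewrite [in RHS](big_cat_nat (n := m)) //= opprD addrA subrK.
  by move=> ->; rewrite raddfD.
by rewrite addrC lerD // ltW // resN // leq_maxr.
Qed.

End Parseval.
End RKHS.

(** Each [lam k] is at most twice the sum of [lam j / j] over [k / 4 <= j <= k]. Exchanging the sums
    leaves, for each [j], the terms [b k] with [k <= 4 * j]. *)
Lemma block_sum_le {R : realType} (lam b : nat -> R) (m N : nat) :
  (forall k, (0 < k)%N -> lam k.+1 <= lam k) -> (forall k, (0 < k)%N -> 0 < lam k) ->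
  (forall k, 0 <= b k) ->
  \sum_(m.+1 <= k < N.+1) lam k * b k <=
  2 * \sum_(0 <= j < N.+1 | (m %/ 4 <= j)%N && (0 < j)%N)
        (lam j / j%:R) * \sum_(1 <= k < (4 * j).+1) b k.
Proof.
move=> lam_decr lam_gt0 b0.
have lam_le j k : (0 < j)%N -> (j <= k)%N -> lam k <= lam j.
  move=> j0; elim: k => [|k IH]; first by rewrite leqn0 => /eqP ->.
  rewrite leq_eqVlt => /predU1P[->//|jk].
  by apply: le_trans (IH jk); rewrite lam_decr // (leq_trans j0).
have w0 j : (0 < j)%N -> 0 <= lam j / j%:R.
  by move=> j0; rewrite divr_ge0 // ltW // lam_gt0.
have inner j : \sum_(m.+1 <= k < N.+1) (k <= 4 * j)%N%:R * b k <=
    \sum_(1 <= k < (4 * j).+1) b k.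
  pose M := maxn N.+1 (4 * j).+1.
  rewrite (@big_nat_widen _ _ _ _ _ M) ?leq_maxl //.
  rewrite [leRHS](@big_nat_widen _ _ _ _ _ M) ?leq_maxr //.
  rewrite (@big_nat_widenl _ _ _ _ 1%N) //.
  rewrite big_mkcond [leRHS]big_mkcond; apply: ler_sum => k _ /=.
  rewrite [(_ < (4 * j).+1)%N]ltnS; case: (k <= 4 * j)%N; rewrite ?mul1r ?mul0r; last by case: ifP.
  by case: ifP.
apply: (@le_trans _ _ (2 * \sum_(0 <= j < N.+1 | (m %/ 4 <= j)%N && (0 < j)%N)
    (lam j / j%:R) * \sum_(m.+1 <= k < N.+1) (k <= 4 * j)%N%:R * b k)); last first.
  rewrite ler_pM2l //; apply: ler_sum => j /andP[_ j0].
  by rewrite ler_wpM2l // w0.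
under [X in _ <= 2 * X]eq_bigr do rewrite mulr_sumr.
rewrite exchange_big /= mulr_sumr big_nat_cond [leRHS]big_nat_cond.
apply: ler_sum => k /andP[/andP[mk kN] _].
have k0 : (0 < k)%N by apply: leq_trans mk.
(* The ceiling of [k / 4], the least [j] with [k <= 4 * j]. At least [k / 2] indices lie between [c]
   and [k], and each has [lam j / j >= lam k / k]. *)
pose c := ((k + 3) %/ 4)%N.
have weight : lam k <= 2 * \sum_(0 <= j < N.+1 | (m %/ 4 <= j)%N && (0 < j)%N)
    (lam j / j%:R) * (k <= 4 * j)%N%:R.
  apply: (@le_trans _ _ (2 * \sum_(c <= j < k.+1) lam k / k%:R)).
    rewrite sumr_const_nat -[X in 2 * X]mulr_natr.
    rewrite [leRHS](_ : _ = lam k * ((2 * (k.+1 - c))%N%:R / k%:R)); last first.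
      by rewrite natrM; ring.
    rewrite ler_peMr ?(ltW (lam_gt0 _ k0)) // ler_pdivlMr ?ltr0n // mul1r ler_nat /c; lia.
  rewrite ler_pM2l // (@big_nat_widen _ _ _ _ _ N.+1) // (@big_nat_widenl _ _ _ _ 0%N) //.
  rewrite big_mkcond [leRHS]big_mkcond; apply: ler_sum => j _ /=.
  case: ifP => [/andP[jk cj]|_]; last first.
    by case: ifP => // /andP[_ j0]; rewrite mulr_ge0 // w0.
  have k4j : (k <= 4 * j)%N by move: cj; rewrite /c; lia.
  have j0 : (0 < j)%N by lia.
  have -> : (m %/ 4 <= j)%N && (0 < j)%N by lia.
  rewrite k4j mulr1 ler_pM ?invr_ge0 // ?(ltW (lam_gt0 _ k0)) ?lam_le //.
  by rewrite lef_pV2 ?posrE ?ltr0n // ler_nat.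
apply: le_trans (ler_wpM2r (b0 k) weight) _.
rewrite -mulrA mulr_suml ler_pM2l //; apply: ler_sum => j _.
by rewrite [leRHS]mulrA.
Qed.

Theorem theorem2p1 :
  exists c1 c2 : nat, (0 < c1)%N /\ (0 < c2)%N /\
  forall (R : realType) (d : nat) (D : set 'rV[R]_d)
    (rho : probability (BorelRd R d) R)
    (K : 'rV[R]_d -> 'rV[R]_d -> R[i]) (H : set ('rV[R]_d -> R[i]))
    (ip : ('rV[R]_d -> R[i]) -> ('rV[R]_d -> R[i]) -> R[i])
    (W : ('rV[R]_d -> R[i]) -> ('rV[R]_d -> R[i]))
    (lam : nat -> R) (e : nat -> 'rV[R]_d -> R[i]),
  (* D_d compact; rho a probability measure on D_d with full support *)
  compact D ->
  rho (D : set (BorelRd R d)) = 1%E ->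
  full_support D rho ->
  (* H(K_d) an RKHS on D_d with Hermitian positive definite continuous kernel *)
  is_RKHS D K H ip ->
  kernel_hermitian D K ->
  kernel_posdef D K ->
  kernel_continuous D K ->
  (exists B : R, forall x, D x -> cabs (K x x) <= B) ->
  (* W_d = I_{2,d}^* I_{2,d} : H -> H, i.e. <W f, g>_H = <f, g>_{L_2(rho)} *)
  (forall f, H f -> H (W f)) ->
  (forall f g, H f -> H g -> ip (W f) g = L2ip rho D f g) ->
  (* all eigenvalues of W_d are positive *)
  (forall (f : 'rV[R]_d -> R[i]) (mu : R[i]), H f -> f <> (fun=> 0) ->
     W f = (fun x => mu * f x) -> 0 < mu) ->
  (* (lam_k, e_k)_{k >= 1}: eigenpairs of W_d, lam_1 >= lam_2 >= ... > 0,
     (e_k)_{k >= 1} an orthonormal basis of H *)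
  (forall k, (0 < k)%N -> H (e k) /\ W (e k) = (fun x => Complex (lam k) 0 * e k x)) ->
  (forall k, (0 < k)%N -> lam k.+1 <= lam k) ->
  (forall k, (0 < k)%N -> 0 < lam k) ->
  (forall j k, (0 < j)%N -> (0 < k)%N -> ip (e j) (e k) = (j == k)%:R) ->
  (forall f, H f -> (forall k, (0 < k)%N -> ip f (e k) = 0) -> f = (fun=> 0)) ->
  forall m : nat, (0 < m)%N ->
  (sampling_number D H ip (c1 * m) * sampling_number D H ip (c1 * m) <=
   c2%:R%:E * maxe
     (Nrho D lam e m * (m%:R^-1)%:E *
        \sum_(k <oo | (m %/ 2 <= k)%N && (0 < k)%N) ((sigma lam k) ^+ 2)%:E)
     (\sum_(k <oo | (m %/ 4 <= k)%N && (0 < k)%N)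
        (Nrho D lam e (4 * k) * ((sigma lam k) ^+ 2 / k%:R)%:E)))%E.
Proof.
(* The 4 counts points per basis function; 512 is 256 from [sampling_number_sqr_le] times 2 from
   [block_sum_le]. *)
exists 4%N, 512%N; split=> //; split=> //.
move=> R d D rho K H ip W lam e cptD rhoD _ rk _ _ contK [B KB] _ _ _ eigen
  lam_decr lam_gt0 one complete_e m m0.
have He k : (0 < k)%N -> H (e k) by move=> /eigen[].
have [x0 Dx0] : D !=set0.
  apply/set0P/eqP => D0; move: rhoD; rewrite D0 measure0 => /eqP.
  by rewrite eqe eq_sym oner_eq0.
set S1 := (Nrho D lam e m * _ * _)%E; set S2 : \bar R := (\sum_(k <oo | _) _)%E.
pose b k x := (cabs (Defs.eta lam e k x)) ^+ 2.
have eta_sqr k x : (0 < k)%N -> (cabs (e k x)) ^+ 2 = lam k * b k x.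
  move=> k0; have lk := lam_gt0 _ k0; rewrite /b /Defs.eta /cabs !sqr_sqrtr ?addr_ge0 ?sqr_ge0 //.
  case: (e k x) => u v /=; rewrite !mul0r subr0 addr0 !exprMn -mulrDr mulrA.
  by rewrite exprVn sqr_sqrtr ?(ltW lk) // divff ?mul1r // gt_eqF.
have b_le n x : D x -> ((\sum_(1 <= k < n.+1) b k x)%:E <= Nrho D lam e n)%E.
  by move=> Dx; apply: ereal_sup_ubound; exists x.
have b0 k x : 0 <= b k x by exact: sqr_ge0.
have N0 n : (0 <= Nrho D lam e n)%E.
  by apply: le_trans (b_le n x0 Dx0); rewrite lee_fin sumr_ge0.
have S2_ge N x : D x ->
    ((\sum_(m.+1 <= k < N.+1) (cabs (e k x)) ^+ 2)%:E <= 2%:E * S2)%E.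
  move=> Dx; rewrite big_nat_cond (eq_bigr (fun k => lam k * b k x)); last first.
    by move=> k /andP[/andP[mk _] _]; rewrite eta_sqr // (leq_trans _ mk).
  rewrite -big_nat_cond.
  apply: (le_trans (y := (2 * \sum_(0 <= j < N.+1 | (m %/ 4 <= j)%N && (0 < j)%N)
      (lam j / j%:R) * \sum_(1 <= k < (4 * j).+1) b k x)%:E)).
    by rewrite lee_fin; apply: block_sum_le.
  rewrite EFinM lee_pmul2l //.
  apply: (le_trans _ (nneseries_lim_ge N.+1 _)) => [|k _ /andP[_ k0]]; last first.
    by rewrite mule_ge0 // lee_fin divr_ge0 ?sqr_ge0.
  rewrite -sumEFin; apply: lee_sum => j /andP[_ j0].
  rewrite EFinM muleC /sigma sqr_sqrtr ?(ltW (lam_gt0 _ j0)) //.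
  apply: lee_wpmul2r; last exact: b_le.
  by rewrite lee_fin divr_ge0 // ltW // lam_gt0.
have S20 : (0 <= S2)%E.
  apply: nneseries_ge0 => k _ /andP[_ k0].
  by rewrite mule_ge0 // lee_fin divr_ge0 ?sqr_ge0.
have Kb : exists c : R[i], forall x, D x -> K x x <= c.
  exists (B%:C)%C => y Dy; rewrite -[leLHS]ger0_norm ?(ksec_diag_ge0 rk Dy) //.
  by rewrite normcE lecR KB.
have le_max_S2 : (512%:R%:E * S2 <= 512%:R%:E * maxe S1 S2)%E.
  by rewrite lee_pmul2l ?lte_fin ?ltr0n // le_max lexx orbT.
apply: le_trans le_max_S2.
case: S2 S20 S2_ge => [s s0 S2_ge|_ _|//]; last by rewrite gt0_muley ?leey // lte_fin.
apply/lee_addgt0Pr => eps eps0; rewrite lee_fin in s0.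
(* The extra term keeps [tau] positive when [s = 0] and becomes [eps] after multiplication by
   256. *)
pose tau := 2 * s + eps / 256.
have tau0 : 0 < tau by rewrite ltr_wpDl ?divr_gt0 ?mulr_ge0.
have res_le x : D x -> residual K (@first_basis R d e m) x <= (tau%:C)%C.
  move=> Dx; apply: (residual_le_tail rk He one complete_e Dx) => N.
  have := S2_ge N x Dx; rewrite -EFinM lee_fin => /le_trans -> //.
  by rewrite lerDl divr_ge0 // ltW.
apply: le_trans (sampling_number_sqr_le rk cptD contK Kb Dx0
  (H_first_basis He (n := m)) (first_basis_orthonormal one (n := m)) tau0 res_le) _.
rewrite -EFinM -EFinD lee_fin /tau; lra.
Qed.
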